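(* Let $G=(V,E)$ be a finite simple graph with maximum vertex degree $\Delta$, let $w\in(0,1)$ and let $M\subseteq E$. Suppose the even subgraph model on $G$ with measure $\lambda(A)=w^{|A\oplus M|}$ has $(\chi_2,\chi_4)$-bounded defect susceptibility, i.e. \[ \frac{\lambda(\mathcal C_2)}{\lambda(\mathcal C_0)}\le \chi_2,\qquad \frac{\lambda(\mathcal C_4)}{\lambda(\mathcal C_0)}\le \chi_4 . \] Then the relaxation time of the lazy worm process on $\mathcal W=\mathcal C_0\cup\mathcal C_2$ satisfies \[ t_{\rm rel}\le 8\,\Delta\, w^{-1}\,|E|\,\bigl[(1+\chi_2)(2+|V|)+2\chi_4\bigr]. \]
   Context: Subgraphs of $G$ are identified with edge subsets $A\subseteq E$; $\oplus$ denotes symmetric difference, $d(u)$ the degree of vertex $u$ in $G$, and $\partial A$ the set of vertices having odd degree in $(V,A)$. $\mathcal C_k=\{A\subseteq E: |\partial A|=k\}$, and for a set $\mathcal S$ of subgraphs $\lambda(\mathcal S)=\sum_{A\in\mathcal S}\lambda(A)$, where $\lambda(A)=w^{|A\oplus M|}$. The state space is $\mathcal W=\mathcal C_0\cup\mathcal C_2$, equipped with the Prokof'ev–Svistunov measure $\pi(A)=\Psi(A)\lambda(A)/(|V|\lambda(\mathcal C_0)+2\lambda(\mathcal C_2))$, where $\Psi(A)=|V|$ if $A\in\mathcal C_0$ and $\Psi(A)=2$ if $A\in\mathcal C_2$. The lazy worm process is the Markov chain on $\mathcal W$ whose transition matrix $P$ is as follows: for $A\in\mathcal W$ and an edge $e=uv\in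 E$ with $A\oplus e\in\mathcal W$, (i) if $A\in\mathcal C_0$: $P(A,A\oplus e)=w^{\mathbf 1[e\notin A\oplus M]}\frac{1}{2|V|}\bigl(\frac1{d(u)}+\frac1{d(v)}\bigr)$; (ii) if $A\in\mathcal C_2$ and $A\oplus e\in\mathcal C_0$: $P(A,A\oplus e)=w^{\mathbf 1[e\notin A\oplus M]}\frac14\bigl(\frac1{d(u)}+\frac1{d(v)}\bigr)$; (iii) if $A\in\mathcal C_2$, $A\oplus e\in\mathcal C_2$ and $u\in\partial A$: $P(A,A\oplus e)=\min\!\bigl(\frac{d(u)}{d(v)}w^{\mathbf 1[e\notin A\oplus M]-\mathbf 1[e\in A\oplus M]},1\bigr)\frac{1}{4d(u)}$; all other off-diagonal entries are $0$ and $P(A,A)=1-\sum_{B\neq A}P(A,B)$. The relaxation time is $t_{\rm rel}=1/\gamma_\ast$, where $\gamma_\ast=1-\max\{|\mu|:\mu\ne 1 \text{ an eigenvalue of } P\}$ is the absolute spectral gap of $P$. *)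

(* Defs.v *)
From HB Require Import structures.
From mathcomp Require Import all_boot all_order all_algebra.
From mathcomp Require Import reals.
From mathcomp Require Import complex.

Set Implicit Arguments.
Unset Strict Implicit.
Unset Printing Implicit Defensive.

Import Order.TTheory GRing.Theory Num.Theory.
Local Open Scope ring_scope.

Section Worm.
(* Finite simple graph G = (V, E): vertex type T, adjacency relation adj,
   assumed symmetric and irreflexive in the theorem. *)
Variables (T : finType) (adj : rel T).

Definition edges : {set {set T}} :=
  [set e : {set T} | [exists u, exists v, adj u v && (e == [set u; v])]].

Definition deg (u : T) : nat := #|[set v | adj u v]|.

Definition maxdeg : nat := \max_(u : T) deg u.

Definition symdiff (A B : {set {set T}}) : {set {set T}} :=
  (A :\: B) :|: (B :\: A).

Definition oddv (A : {set {set T}}) : {set T} :=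
  [set u | odd #|[set e in A | u \in e]|].

Definition Ck (k : nat) : {set {set {set T}}} :=
  [set A : {set {set T}} | (A \subset edges) && (#|oddv A| == k)].

Variables (R : realType) (w : R) (M : {set {set T}}).

Definition lam (A : {set {set T}}) : R := w ^+ #|symdiff A M|.

Definition lamS (S : {set {set {set T}}}) : R := \sum_(A in S) lam A.

Definition Wset : {set {set {set T}}} := Ck 0 :|: Ck 2.
Definition Wty : finType := {A : {set {set T}} | A \in Wset}.

(* the rate of flipping edge e = uv in state A, as given by (i)-(iii);
   for (iii) the formula is taken with the endpoint lying in \partial A
   (the expression is symmetric in u, v whenever the move is valid). *)
Definition rate (A : {set {set T}}) (u v : T) : R :=
  let e := [set u; v] in
  let B := symdiff A [set e] in
  let inAM := e \in symdiff A M in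
  let s : R := if inAM then 1 else w in
  let t : R := if inAM then w^-1 else w in
  let du : R := (deg u)%:R in
  let dv : R := (deg v)%:R in
  if #|oddv A| == 0%N then
    s * ((2 * (#|T|)%:R)^-1 * (du^-1 + dv^-1))
  else if #|oddv B| == 0%N then
    s * (4^-1 * (du^-1 + dv^-1))
  else if u \in oddv A then
    Num.min (du / dv * t) 1 * (4 * du)^-1
  else
    Num.min (dv / du * t) 1 * (4 * dv)^-1.

(* off-diagonal entry P(A,B), A != B: sum over the (unique, if any) edge e
   with B = A (+) e; each edge {u,v} is visited twice as (u,v) and (v,u),
   hence the factor 1/2 *)
Definition Poff (A B : {set {set T}}) : R :=
  2^-1 * \sum_(u : T) \sum_(v : T | adj u v && (B == symdiff A [set [set u; v]]))
           rate A u v.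

Definition Pw (A B : Wty) : R :=
  if A == B then 1 - \sum_(C : Wty | C != A) Poff (val A) (val C)
  else Poff (val A) (val B).

Definition Pmx : 'M[R]_#|Wty| :=
  \matrix_(i, j) Pw (enum_val i) (enum_val j).

(* t_rel <= B, where t_rel = 1/gamma_*, gamma_* = 1 - max{|mu| : mu != 1
   eigenvalue of P} (complex eigenvalues): every nontrivial eigenvalue mu
   satisfies |mu| < 1 and 1/(1 - |mu|) <= B. *)
Definition trel_le (Bd : R) : Prop :=
  forall mu : R[i],
    eigenvalue (map_mx (fun x : R => x%:C%C) Pmx) mu -> mu != 1 ->
    `|mu| < 1 /\ (1 - `|mu|)^-1 <= Bd%:C%C.

End Worm.

(* Main.v *)
Require Import Defs.
From HB Require Import structures.
From mathcomp Require Import all_boot all_order all_algebra.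
From mathcomp Require Import boolp reals.
From mathcomp Require Import complex.
From mathcomp Require Import ring lra zify.
Import Order.TTheory GRing.Theory Num.Theory.
Local Open Scope ring_scope.

(** The chain is reversible for the weight [rho A = psi A * lam A] and stays put
    with probability at least 1/2, so its eigenvalues lie in [[0, 1]] and it suffices to
    prove a Poincare inequality.  The variance is at most the mean of
    [(g A - g B) ^+ 2] with [A] drawn from [rho] and [B] from [lam] restricted to
    the even subgraphs; the difference is telescoped along a path from [A] to [B]
    that flips each edge of [D = symdiff A B] once.  The order of the flips depends
    on [D] only.  If [X] is the current state, then [eta = symdiff X D] agrees
    edge by edge with whichever of [A] and [B] the state [X] does not, so
    [lam A * lam B = lam X * lam eta], and [eta] has at most four odd vertices.
    For a fixed transition [D] is recovered from [eta], so the congestion is at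
    most the total weight of the possible [eta]. *)

(** * Reversible lazy chains: from a Poincare inequality to the eigenvalues *)

Section Reversible.
Set Implicit Arguments.
Unset Strict Implicit.
Variables (R : rcfType) (I : finType) (p : I -> I -> R) (r : I -> R).
Hypothesis r_gt0 : forall x, 0 < r x.
Hypothesis rev : forall x y, r x * p x y = r y * p y x.
Hypothesis p_sum1 : forall x, \sum_y p x y = 1.

Definition dirichlet (h : I -> R) : R :=
  2^-1 * \sum_x \sum_y r x * p x y * (h x - h y) ^+ 2.

(** Self-adjointness of [p] for the inner product weighted by [r]. *)
Lemma sum_rev_sym (f g : I -> R) :
  \sum_x r x * f x * (\sum_y p x y * g y) =
  \sum_x r x * g x * (\sum_y p x y * f y).
Proof.
under eq_bigr do rewrite mulr_sumr; rewrite exchange_big /=.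
apply: eq_bigr => y _; rewrite mulr_sumr; apply: eq_bigr => x _.
have := rev x y; move: (r x) (r y) (p x y) (p y x) => a b c d h.
have -> : a * f x * (c * g y) = (a * c) * f x * g y by ring.
by rewrite h; ring.
Qed.

(** One square term collapses by [p_sum1], the other by stationarity of [r], which [rev] supplies.
    The case [s = -1] computes [dirichlet]; the case [s = 1] bounds eigenvalues from below. *)
Lemma sum_quadratic (h : I -> R) (s : R) :
  \sum_x \sum_y r x * p x y * (h x + s * h y) ^+ 2 =
  (1 + s ^+ 2) * (\sum_x r x * h x ^+ 2) +
  2 * s * (\sum_x r x * h x * (\sum_y p x y * h y)).
Proof.
have E1 : \sum_x \sum_y r x * p x y * h x ^+ 2 = \sum_x r x * h x ^+ 2.
  apply: eq_bigr => x _; rewrite -[RHS]mulr1 -(p_sum1 x) mulr_sumr.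
  by apply: eq_bigr => y _; ring.
have E2 : \sum_x \sum_y r x * p x y * h y ^+ 2 = \sum_x r x * h x ^+ 2.
  rewrite exchange_big -E1 /=; apply: eq_bigr => x _; apply: eq_bigr => y _.
  by rewrite (rev y x).
rewrite mulrDl mul1r -{1}E1 -E2 !mulr_sumr -!big_split /=.
apply: eq_bigr => x _; rewrite !mulr_sumr -!big_split /=.
by apply: eq_bigr => y _; ring.
Qed.

(** Since [m != 1], the function [h] has mean zero, so the Poincare inequality applies to it, and
    [dirichlet h] is [1 - m] times its squared norm. Laziness gives [0 <= m]. *)
Lemma rev_real_eigen (h : I -> R) (m C : R) :
  (forall x y, 0 <= p x y) -> (forall x, 2^-1 <= p x x) ->
  (forall g : I -> R, \sum_x r x * g x = 0 ->
     \sum_x r x * g x ^+ 2 <= C * dirichlet g) ->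
  (forall x, \sum_y p x y * h y = m * h x) -> (exists x, h x != 0) -> m != 1 ->
  0 <= m < 1 /\ (1 - m)^-1 <= C.
Proof.
move=> p_ge0 lazy poinc Ph [x0 hx0] m_neq1.
set N := \sum_x r x * h x ^+ 2.
have N_gt0 : 0 < N.
  rewrite /N (bigD1 x0) //= ltr_pwDl //.
    by rewrite mulr_gt0 // lt_def sqr_ge0 andbT sqrf_eq0.
  by apply: sumr_ge0 => x _; rewrite mulr_ge0 ?sqr_ge0 // ltW.
have hPh : \sum_x r x * h x * (\sum_y p x y * h y) = m * N.
  by rewrite mulr_sumr; apply: eq_bigr => x _; rewrite Ph; ring.
have mean0 : \sum_x r x * h x = 0.
  have : \sum_x r x * h x = m * \sum_x r x * h x.
    transitivity (\sum_x r x * h x * (\sum_y p x y * 1)).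
      by apply: eq_bigr => x _; rewrite -mulr_suml p_sum1 !mulr1.
    rewrite (sum_rev_sym h (fun=> 1)) mulr_sumr; apply: eq_bigr => x _.
    by rewrite Ph; ring.
  move/eqP; rewrite -subr_eq0 -{1}[X in X - _]mul1r -mulrBl mulf_eq0 subr_eq0.
  by rewrite eq_sym (negbTE m_neq1) => /eqP.
have dirE : dirichlet h = (1 - m) * N.
  have := sum_quadratic h (-1); rewrite hPh -/N => E.
  rewrite /dirichlet; transitivity (2^-1 * (\sum_x \sum_y r x * p x y * (h x + -1 * h y) ^+ 2)).
    by congr (_ * _); apply: eq_bigr => x _; apply: eq_bigr => y _; rewrite mulN1r.
  by rewrite E; field.
have dir_ge0 : 0 <= dirichlet h.
  rewrite /dirichlet mulr_ge0 ?invr_ge0 //.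
  apply: sumr_ge0 => x _; apply: sumr_ge0 => y _.
  by rewrite mulr_ge0 ?sqr_ge0 // mulr_ge0 // ltW.
have m_le1 : 0 <= 1 - m by move: dir_ge0; rewrite dirE pmulr_lge0.
have m_lt1 : m < 1 by rewrite lt_neqAle m_neq1 -subr_ge0.
have m_ge0 : 0 <= m.
  (* The right side is the sum of [r x * p x y * (h x + h y) ^+ 2]. Its diagonal terms alone reach
     [2 * N], because [(2 * h x) ^+ 2] carries a factor 4 and [p x x] is at least 1/2. *)
  have : 2 * N <= 2 * N + 2 * (m * N).
    have -> : 2 * N + 2 * (m * N) = (1 + 1 ^+ 2) * N + 2 * 1 * (m * N) by ring.
    rewrite -hPh -sum_quadratic /N mulr_sumr; apply: ler_sum => x _.
    rewrite (bigD1 x) //=; apply: ler_wpDr.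
      apply: sumr_ge0 => y _; by rewrite mulr_ge0 ?sqr_ge0 // mulr_ge0 // ltW.
    have := lazy x; have : 0 <= r x * h x ^+ 2 by rewrite mulr_ge0 ?sqr_ge0 // ltW.
    by move: (r x) (h x) (p x x) => a b c; nra.
  by rewrite lerDl pmulr_rge0 // pmulr_lge0.
split; first by rewrite m_ge0.
have := poinc h mean0; rewrite dirE -/N mulrA -{1}[N]mul1r ler_pM2r // => H.
by rewrite -[_^-1]mul1r ler_pdivrMr // subr_gt0.
Qed.

(* Reversibility makes [p] self-adjoint for the inner product weighted by [r], so
   a complex eigenvalue is real and has a real eigenvector. *)
Lemma rev_eigenvalue_gap (C : R) :
  (forall x y, 0 <= p x y) -> (forall x, 2^-1 <= p x x) ->
  (forall g : I -> R, \sum_x r x * g x = 0 ->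
     \sum_x r x * g x ^+ 2 <= C * dirichlet g) ->
  forall mu : R[i],
    eigenvalue (map_mx (fun x : R => x%:C%C)
      (\matrix_(i < #|I|, j < #|I|) p (enum_val i) (enum_val j))) mu ->
    mu != 1 -> `|mu| < 1 /\ (1 - `|mu|)^-1 <= C%:C%C.
Proof.
move=> p_ge0 lazy poinc mu /eigenvalueP [v vP v_neq0] mu_neq1.
have eqv y : \sum_x v 0 (enum_rank x) * (p x y)%:C%C = mu * v 0 (enum_rank y).
  have := congr1 (fun u : 'rV_ _ => u 0 (enum_rank y)) vP; rewrite !mxE => <-.
  rewrite (reindex (@enum_rank I)) /=; last by apply: onW_bij; exact: enum_rank_bij.
  by apply: eq_bigr => x _; rewrite !mxE !enum_rankK.
case: mu => m n in vP mu_neq1 eqv *.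
pose a x := complex.Re (v 0 (enum_rank x)); pose b x := complex.Im (v 0 (enum_rank x)).
have vE x : v 0 (enum_rank x) = (a x +i* b x)%C by rewrite /a /b; case: (v _ _).
have eqa y : \sum_x a x * p x y = m * a y - n * b y.
  have := congr1 (@complex.Re R) (eqv y); rewrite raddf_sum vE /= => <-.
  by apply: eq_bigr => x _; rewrite vE /= mulr0 subr0.
have eqb y : \sum_x b x * p x y = m * b y + n * a y.
  have := congr1 (@complex.Im R) (eqv y); rewrite raddf_sum vE /= => <-.
  by apply: eq_bigr => x _; rewrite vE /= mulr0 add0r.
(* [eigenvalue] concerns row vectors; by reversibility, division by [r] turns a left eigenvector
   into a right one. *)
pose f x := a x / r x; pose g x := b x / r x.
have rn0 x : r x != 0 by rewrite gt_eqF.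
have transp (c : I -> R) y : \sum_x p y x * (c x / r x) = (\sum_x c x * p x y) / r y.
  rewrite mulr_suml; apply: eq_bigr => x _; have := rev y x.
  have := rn0 x; have := rn0 y; move: (r x) (r y) (p x y) (p y x) => s t u q t0 s0 E.
  have -> : q = s * u / t by rewrite -E; field.
  by field; rewrite s0 t0.
have Pf y : \sum_x p y x * f x = m * f y - n * g y.
  by rewrite transp eqa /f /g mulrBl !mulrA.
have Pg y : \sum_x p y x * g x = m * g y + n * f y.
  by rewrite transp eqb /f /g mulrDl !mulrA.
(* The left side is the difference of the two sides of [sum_rev_sym] for [f] and [g]; this is what
   forces the imaginary part [n] to vanish. *)
have nN : n * \sum_x (r x * f x ^+ 2 + r x * g x ^+ 2) = 0.
  transitivity (\sum_x (r x * f x * (\sum_y p x y * g y) -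
                        r x * g x * (\sum_y p x y * f y))).
    by rewrite mulr_sumr; apply: eq_bigr => x _; rewrite Pf Pg; ring.
  by rewrite sumrB sum_rev_sym subrr.
have [x vx_neq0] : exists x, v 0 (enum_rank x) != 0.
  apply/existsP; apply: contraR v_neq0; rewrite negb_exists => /forallP v0.
  by apply/eqP/rowP => i; rewrite mxE -(enum_valK i); apply/eqP;
    move: (v0 (enum_val i)); rewrite negbK.
have fg_neq0 : (f x != 0) || (g x != 0).
  apply: contraR vx_neq0; rewrite negb_or !negbK vE /f /g !mulf_eq0 !invr_eq0.
  by rewrite (negbTE (rn0 x)) !orbF => /andP[/eqP-> /eqP->].
have n0 : n = 0.
  move/eqP: nN; rewrite mulf_eq0 => /orP[/eqP //|].
  have pos y : 0 <= r y * f y ^+ 2 + r y * g y ^+ 2.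
    by rewrite addr_ge0 // mulr_ge0 ?sqr_ge0 // ltW.
  rewrite psumr_eq0 // => /allP /(_ x (mem_index_enum x)) /=.
  rewrite -mulrDr mulf_eq0 (negbTE (rn0 x)) /= paddr_eq0 ?sqr_ge0 // !sqrf_eq0.
  by move=> /andP[/eqP f0 /eqP g0]; rewrite f0 g0 eqxx in fg_neq0.
subst n.
have m_neq1 : m != 1 by apply: contra mu_neq1 => /eqP ->.
have {}Pf y : \sum_x p y x * f x = m * f y by rewrite Pf mul0r subr0.
have {}Pg y : \sum_x p y x * g x = m * g y by rewrite Pg mul0r addr0.
have [/andP[m_ge0 m_lt1] m_C] : 0 <= m < 1 /\ (1 - m)^-1 <= C.
  by case/orP: fg_neq0 => h0; [apply: (rev_real_eigen p_ge0 lazy poinc Pf) => // |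
    apply: (rev_real_eigen p_ge0 lazy poinc Pg) => //]; exists x.
have -> : (m +i* 0)%C = m%:C%C by [].
rewrite ger0_norm ?ler0c //.
rewrite -(rmorph1 (real_complex R)) -rmorphB -fmorphV /= ltcR lecR.
by split.
Qed.
End Reversible.

(** * Symmetric differences of edge sets and their odd vertices *)

Section EdgeSets.
Set Implicit Arguments.
Unset Strict Implicit.
Variables (T : finType) (adj : rel T).
Hypotheses (adj_sym : symmetric adj) (adj_irr : irreflexive adj).

Local Notation ES := {set {set T}}.
Local Notation "A :+: B" := (symdiff A B) (at level 50, left associativity).

Lemma in_symdiff (A B : ES) x : (x \in A :+: B) = (x \in A) (+) (x \in B).
Proof. by rewrite !inE; case: (x \in A); case: (x \in B). Qed.

Lemma symdiffC (A B : ES) : A :+: B = B :+: A.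
Proof. by apply/setP => x; rewrite !in_symdiff addbC. Qed.

Lemma symdiffA (A B C : ES) : A :+: (B :+: C) = A :+: B :+: C.
Proof. by apply/setP => x; rewrite !in_symdiff addbA. Qed.

Lemma symdiff0 (A : ES) : A :+: set0 = A.
Proof. by apply/setP => x; rewrite in_symdiff inE addbF. Qed.

Lemma symdiffK (B A : ES) : A :+: B :+: B = A.
Proof. by apply/setP => x; rewrite !in_symdiff addbK. Qed.

Lemma symdiffKl (A B : ES) : A :+: (A :+: B) = B.
Proof. by rewrite symdiffC (symdiffC A) symdiffK. Qed.

Lemma symdiff_sub (A B S : ES) : A \subset S -> B \subset S -> A :+: B \subset S.
Proof.
by move=> AS BS; apply/subsetP => x; rewrite !inE => /orP[] /andP[_];
  [apply: (subsetP AS) | apply: (subsetP BS)].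
Qed.

(** The intersection is counted twice. The form by membership serves both for the edges at a vertex
    and for sets of vertices. *)
Lemma odd_card_symdiff (I : finType) (A B C : {set I}) :
  (forall x, (x \in C) = (x \in A) (+) (x \in B)) ->
  odd #|C| = odd #|A| (+) odd #|B|.
Proof.
move=> CE; have -> : C = (A :\: B) :|: (B :\: A).
  by apply/setP => x; rewrite CE !inE; case: (x \in A); case: (x \in B).
have dis : [disjoint A :\: B & B :\: A].
  by apply/pred0P => x; rewrite /= !inE; case: (x \in A); case: (x \in B).
have := leq_card_setU (A :\: B) (B :\: A); rewrite dis => -[_ /eqP ->].
rewrite oddD -(cardsID B A) -(cardsID A B) !oddD (setIC B A).
by case: (odd _); case: (odd _); case: (odd _).
Qed.

Lemma in_oddv_symdiff (A B : ES) u :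
  (u \in oddv (A :+: B)) = (u \in oddv A) (+) (u \in oddv B).
Proof.
rewrite !inE; apply: odd_card_symdiff => e; rewrite !inE -/(symdiff A B).
by rewrite -[RHS]andb_addl; case: (u \in e); rewrite ?andbF ?andbT //;
  case: (e \in A); case: (e \in B).
Qed.

Lemma in_oddv1 (e : {set T}) u : (u \in oddv [set e]) = (u \in e).
Proof.
rewrite inE; case: (boolP (u \in e)) => ue.
  have -> : [set e0 in [set e] | u \in e0] = [set e].
    by apply/setP => x; rewrite !inE; case: eqP => // ->.
  by rewrite cards1.
have -> : [set e0 in [set e] | u \in e0] = set0.
  by apply/setP => x; rewrite !inE; case: eqP => // ->; rewrite (negbTE ue).
by rewrite cards0.
Qed.

Lemma in_oddv_flip (A : ES) e u :
  (u \in oddv (A :+: [set e])) = (u \in oddv A) (+) (u \in e).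
Proof. by rewrite in_oddv_symdiff in_oddv1. Qed.

Lemma oddv0 : oddv (set0 : ES) = set0.
Proof.
apply/setP => u; rewrite !inE; have -> : [set e in set0 : ES | u \in e] = set0 :> ES.
  by apply/setP => x; rewrite !inE.
by rewrite cards0.
Qed.

Lemma oddv_symdiff_even (A B : ES) : #|oddv A| = 0%N -> oddv (A :+: B) = oddv B.
Proof.
move/eqP; rewrite cards_eq0 => /eqP A0.
by apply/setP => u; rewrite in_oddv_symdiff A0 inE.
Qed.

Lemma card_oddv_symdiff (A B : ES) :
  (#|oddv (A :+: B)| <= #|oddv A| + #|oddv B|)%N.
Proof.
apply: leq_trans (leq_card_setU _ _); apply: subset_leq_card.
apply/subsetP => u; rewrite in_setU in_oddv_symdiff.
by case: (u \in oddv A).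
Qed.

(** * Edges of the graph, parity, and the order of the flips *)

Lemma edgesP (e : {set T}) :
  reflect (exists u v, adj u v /\ e = [set u; v]) (e \in edges adj).
Proof.
rewrite inE; apply: (iffP existsP) => [[u /existsP[v /andP[a /eqP ->]]]|].
  by exists u, v.
by move=> [u [v [a ->]]]; exists u; apply/existsP; exists v; rewrite a eqxx.
Qed.

Lemma mem_edges u v : adj u v -> [set u; v] \in edges adj.
Proof. by move=> a; apply/edgesP; exists u, v. Qed.

Lemma adj_neq u v : adj u v -> u != v.
Proof. by move=> a; apply: contraTneq a => ->; rewrite adj_irr. Qed.

Lemma card_edge e : e \in edges adj -> #|e| = 2%N.
Proof. by case/edgesP => u [v [a ->]]; rewrite cards2 adj_neq. Qed.

Lemma flip_in (D : ES) e : e \in D -> D :+: [set e] = D :\ e.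
Proof.
move=> eD; apply/setP => x; rewrite !inE.
by case: (eqVneq x e) => [->|_]; rewrite ?eD //; case: (x \in D).
Qed.

(** Handshake lemma: removing an edge toggles exactly its two ends, which preserves the parity of
    [#|oddv A|]. *)
Lemma even_oddv (A : ES) : A \subset edges adj -> ~~ odd #|oddv A|.
Proof.
have [n] := ubnP #|A|; elim: n A => // n IH A An AE.
have [->|[e eA]] := set_0Vmem A; first by rewrite oddv0 cards0.
have -> : odd #|oddv A| = odd #|oddv (A :\ e)| (+) odd #|e|.
  apply: odd_card_symdiff => u; rewrite -in_oddv_flip -(flip_in eA).
  by rewrite symdiffK.
rewrite (card_edge (subsetP AE _ eA)) addbF IH //.
  by rewrite (cardsD1 e A) eA in An.
exact: subset_trans (subD1set _ _) AE.
Qed.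

(** If [D] is even, any edge will do, and its two ends become odd. Otherwise an edge at an odd
    vertex [x] is taken: [x] becomes even and at most the other end becomes odd. *)
Lemma flip_edge_oddv_le2 (D : ES) : D \subset edges adj -> D != set0 ->
  (#|oddv D| <= 2)%N -> exists2 e, e \in D & (#|oddv (D :+: [set e])| <= 2)%N.
Proof.
move=> DE D0 D2.
have [oD0|[x xD]] := set_0Vmem (oddv D).
  have [e eD] := set0Pn _ D0; exists e => //.
  rewrite oddv_symdiff_even ?oD0 ?cards0 //.
  have -> : oddv [set e] = e by apply/setP => u; rewrite in_oddv1.
  by rewrite card_edge // (subsetP DE).
have [e eD xe] : exists2 e, e \in D & x \in e.
  move: xD; rewrite inE => /odd_gt0 /card_gt0P [e]; rewrite !inE => /andP[eD xe].
  by exists e.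
exists e => //.
have : oddv (D :+: [set e]) \subset (oddv D :\ x) :|: (e :\ x).
  apply/subsetP => u; rewrite in_oddv_flip !in_setU !in_setD1.
  by case: eqVneq => [->|] /=; rewrite ?xD ?xe //; case: (u \in oddv D).
move/subset_leq_card/leq_trans; apply.
apply: leq_trans (leq_card_setU _ _) _.
have := cardsD1 x (oddv D); have := cardsD1 x e; rewrite xD xe.
by rewrite (card_edge (subsetP DE _ eD)); lia.
Qed.

(* [pre e] is the set of edges of [D] flipped before [e]. *)
Definition unwinds (R : zmodType) (D : ES) (pre : {set T} -> ES) : Prop :=
  (forall e, e \in D -> [/\ pre e \subset D, (#|oddv (D :+: pre e)| <= 2)%N &
     (#|oddv (D :+: pre e :+: [set e])| <= 2)%N]) /\
  (forall (f : ES -> R) A,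
     f A - f (A :+: D) =
     \sum_(e in D) (f (A :+: pre e) - f (A :+: pre e :+: [set e]))).

(* The edges of [D] are removed greedily, each time keeping at most two odd
   vertices, so no decomposition into paths and cycles is needed. *)
Lemma exists_unwinding (R : zmodType) (D : ES) :
  D \subset edges adj -> (#|oddv D| <= 2)%N -> exists pre, unwinds R D pre.
Proof.
have [n] := ubnP #|D|; elim: n D => // n IH D Dn DE D2.
have [->|D0] := eqVneq D set0.
  exists (fun=> set0); split=> [e|f A]; first by rewrite inE.
  by rewrite symdiff0 subrr big_set0.
have [e0 e0D D'2] := flip_edge_oddv_le2 DE D0 D2.
have D'E := flip_in e0D.
have DD' : D = [set e0] :+: (D :\ e0) by rewrite -D'E symdiffC symdiffK.
have [||pre [preP preS]] := IH (D :\ e0) _ (subset_trans (subD1set _ _) DE).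
- by rewrite (cardsD1 e0 D) e0D in Dn.
- by rewrite -D'E.
(* [e0] is flipped first, so every other prefix gains [e0]. *)
exists (fun e => if e == e0 then set0 else [set e0] :+: pre e); split.
  move=> e eD; case: eqVneq => [->|ne]; first by rewrite symdiff0 sub0set.
  have /preP[p1 p2 p3] : e \in D :\ e0 by rewrite !inE ne.
  rewrite symdiffA D'E; split=> //.
  by apply: symdiff_sub; rewrite ?sub1set // (subset_trans p1) ?subD1set.
move=> f A; rewrite (big_setD1 e0) //= eqxx symdiff0.
have -> : A :+: D = A :+: [set e0] :+: (D :\ e0) by rewrite {1}DD' symdiffA.
rewrite -(subrKA (f (A :+: [set e0]))) preS; congr (_ + _).
apply: eq_bigr => e; rewrite !inE => /andP[/negbTE -> _].
by rewrite !symdiffA.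
Qed.

(** A single family indexed by [D] alone, and not by the ends of a path, so that [D] and the flipped
    edge determine the prefix in the congestion bound. *)
Lemma exists_unwindings (R : zmodType) :
  exists pre : ES -> {set T} -> ES, forall D : ES,
    D \subset edges adj -> (#|oddv D| <= 2)%N -> unwinds R D (pre D).
Proof.
have ex (D : ES) : exists pre,
    D \subset edges adj -> (#|oddv D| <= 2)%N -> unwinds R D pre.
  have [/andP[DE D2]|h] := boolP ((D \subset edges adj) && (#|oddv D| <= 2)%N).
    by have [pre preP] := exists_unwinding R DE D2; exists pre.
  by exists (fun=> set0) => DE D2; rewrite DE D2 in h.
by have [pre preP] := choice ex; exists pre.
Qed.

Lemma CkE k (A : ES) : (A \in Ck adj k) = (A \subset edges adj) && (#|oddv A| == k).
Proof. by rewrite inE. Qed.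

(** By parity, exactly one odd vertex is impossible. *)
Lemma WsetE (A : ES) :
  (A \in Wset adj) = (A \subset edges adj) && (#|oddv A| <= 2)%N.
Proof.
rewrite inE !CkE; case: (boolP (A \subset _)) => //= /even_oddv.
by case: #|_| => [|[|[|]]].
Qed.

(** * The weights of edge sets *)

Variables (R : realType) (w : R) (M : ES).
Hypotheses (w_gt0 : 0 < w) (w_lt1 : w < 1).

Local Notation lam := (lam w M).
Local Notation rate := (rate adj w M).
Local Notation Poff := (Poff adj w M).
Local Notation W := (Wset adj).
Local Notation dg u := ((deg adj u)%:R : R).

Lemma lam_gt0 A : 0 < lam A.
Proof. exact: exprn_gt0. Qed.

Lemma lam_prod A : lam A = \prod_e (if e \in A :+: M then w else 1).
Proof. by rewrite /Defs.lam -prodr_const big_mkcond. Qed.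

(** Edge by edge: on [P] the sets [A] and [A :+: D] disagree, so flipping [P] in both swaps their
    two factors; off [P] nothing changes. *)
Lemma lam_exchange (A D P : ES) : P \subset D ->
  lam A * lam (A :+: D) = lam (A :+: P) * lam (A :+: P :+: D).
Proof.
move=> /subsetP PD; rewrite !lam_prod -!big_split /=; apply: eq_bigr => e _.
rewrite !in_symdiff; have := PD e.
case: (e \in P); case: (e \in D) => // h; rewrite ?addbF //; last by have := h isT.
by case: (e \in A); case: (e \in M) => /=; rewrite mulrC.
Qed.

Lemma lam_flip A e :
  lam (A :+: [set e]) = lam A * (if e \in A :+: M then w^-1 else w).
Proof.
rewrite !lam_prod (bigD1 e) //= [in RHS](bigD1 e) //= mulrAC.
congr (_ * _); last first.
  by apply: eq_bigr => x /negbTE xe; rewrite !in_symdiff inE xe addbF.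
rewrite !in_symdiff inE eqxx addbT; case: (e \in A); case: (e \in M) => /=;
  by rewrite ?mul1r // divff // gt_eqF.
Qed.

(** Both sides are the smaller of [lam A] and [lam B]. *)
Lemma lam_flip_min A e : let B := A :+: [set e] in
  lam A * (if e \in A :+: M then 1 else w) =
  lam B * (if e \in B :+: M then 1 else w).
Proof.
move=> /=; rewrite lam_flip !in_symdiff inE eqxx addbT.
by case: (e \in A); case: (e \in M) => /=; rewrite ?mulr1 // mulfVK // gt_eqF.
Qed.

Definition psi (A : ES) : R := if #|oddv A| == 0%N then #|T|%:R else 2.
(** On [W], the Prokof'ev-Svistunov measure without its normalising constant. *)
Definition rho (A : ES) : R := psi A * lam A.

(** * Transition rates: detailed balance and a lower bound on the flow *)

Lemma natr_card_gt0 (u : T) : 0 < #|T|%:R :> R.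
Proof. by rewrite ltr0n; apply/card_gt0P; exists u. Qed.

Lemma deg_gt0 u v : adj u v -> 0 < dg u.
Proof. by move=> a; rewrite ltr0n; apply/card_gt0P; exists v; rewrite inE. Qed.

Lemma deg_gt0r u v : adj u v -> 0 < dg v.
Proof. by rewrite adj_sym => /deg_gt0. Qed.

Lemma deg_le_max u : dg u <= (maxdeg adj)%:R.
Proof. by rewrite ler_nat /maxdeg (bigD1 u) //= leq_maxl. Qed.

Lemma oddv_flip_both (A : ES) u v : #|oddv (A :+: [set [set u; v]])| = 0%N ->
  (u \in oddv A) && (v \in oddv A).
Proof.
move/eqP; rewrite cards_eq0 => /eqP B0.
have h x : (x \in oddv A) = (x \in [set u; v]).
  by have := in_oddv_flip A [set u; v] x; rewrite B0 in_set0; case: (_ \in _); case: (_ \in _).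
by rewrite !h !in_set2 !eqxx orbT.
Qed.

Lemma card_oddv_W A : A \in W -> #|oddv A| != 0%N -> #|oddv A| = 2%N.
Proof.
by rewrite WsetE => /andP[/even_oddv]; case: #|_| => [|[|[|]]].
Qed.

Lemma oddv_flip_one_imp A u v : adj u v -> A \in W ->
  #|oddv A| != 0%N -> #|oddv (A :+: [set [set u; v]])| != 0%N ->
  ~~ ((u \in oddv A) && (v \in oddv A)).
Proof.
move=> a AW A0; apply: contra => /andP[uA vA].
have E : oddv A = [set u; v].
  apply/esym/eqP; rewrite eqEcard (card_oddv_W AW A0) cards2 adj_neq //= andbT.
  by apply/subsetP => x; rewrite in_set2 => /orP[] /eqP ->.
rewrite cards_eq0; apply/eqP/setP => x.
by rewrite in_oddv_flip E addbb in_set0.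
Qed.

(** If both ends were odd, the flipped set would be even; if neither were, the same argument applies
    with the roles of the two sets exchanged. *)
Lemma oddv_flip_one A u v : adj u v -> A \in W -> A :+: [set [set u; v]] \in W ->
  #|oddv A| != 0%N -> #|oddv (A :+: [set [set u; v]])| != 0%N ->
  (v \in oddv A) = (u \notin oddv A).
Proof.
move=> a AW BW A0 B0.
have h1 := oddv_flip_one_imp a AW A0 B0.
have := oddv_flip_one_imp a BW B0; rewrite symdiffK => /(_ A0).
rewrite !in_oddv_flip !in_set2 !eqxx orbT !addbT.
by move: h1; case: (u \in _); case: (v \in _).
Qed.

(** [psi A] cancels the prefactor of the rate: [#|T|] against [(2 * #|T|)^-1], or 2 against [4^-1],
    leaves [2^-1] in both cases. *)
Lemma rho_rate_end A u v : adj u v ->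
  let B := A :+: [set [set u; v]] in
  (#|oddv A| == 0%N) || (#|oddv B| == 0%N) ->
  rho A * rate A u v =
  2^-1 * (lam A * (if [set u; v] \in A :+: M then 1 else w)) * ((dg u)^-1 + (dg v)^-1).
Proof.
move=> a B; rewrite /rho /psi /Defs.rate -/B.
case: eqP => [_ _|_ /= ->].
  by have := natr_card_gt0 u; move: (lam A) (_ + _) (if _ then _ else _) => x y z h;
    field; rewrite gt_eqF.
by move: (lam A) (_ + _) (if _ then _ else _) => x y z; field.
Qed.

(** Multiplying out the Metropolis minimum compares, for a valid move, the weight of each state
    divided by the degree of the end of the edge that is odd in it. In this form the symmetry
    between [A] and [B] is visible. *)
Lemma rho_rate_mid A u v : adj u v ->
  let B := A :+: [set [set u; v]] in
  #|oddv A| != 0%N -> #|oddv B| != 0%N ->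
  rho A * rate A u v = 2^-1 *
    (if u \in oddv A then Num.min (lam B / dg v) (lam A / dg u)
     else Num.min (lam B / dg u) (lam A / dg v)).
Proof.
move=> a B A0 B0; rewrite /rho /psi /Defs.rate -/B (negbTE A0) (negbTE B0) [lam B]lam_flip.
have hu := deg_gt0 a; have hv := deg_gt0r a; have hl := lam_gt0 A.
have key (x y t : R) : 0 < x -> 0 < y ->
    2 * lam A * (Num.min (x / y * t) 1 * (4 * x)^-1) =
    2^-1 * Num.min (lam A * t / y) (lam A / x).
  move=> x0 y0; have -> : lam A * t / y = lam A / x * (x / y * t).
    by field; rewrite !gt_eqF.
  rewrite -{2}[lam A / x]mulr1 -minr_pMr ?divr_ge0 ?ltW //.
  by field; rewrite gt_eqF.
by case: ifP => _; rewrite key.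
Qed.

Lemma rho_rate_sym A u v : adj u v ->
  let B := A :+: [set [set u; v]] in
  A \in W -> B \in W -> rho A * rate A u v = rho B * rate B u v.
Proof.
move=> a B AW BW.
have BA : B :+: [set [set u; v]] = A by rewrite symdiffK.
have [h|] := boolP ((#|oddv A| == 0%N) || (#|oddv B| == 0%N)).
  rewrite (rho_rate_end a) // (rho_rate_end a); last by rewrite BA orbC.
  by rewrite lam_flip_min.
rewrite negb_or => /andP[A0 B0].
rewrite (rho_rate_mid a) // (rho_rate_mid a) ?BA //.
(* The flip toggles the oddness of [u], so [B] takes the other branch, whose minimum has the same
   two arguments in the opposite order. *)
rewrite -/B; have := in_oddv_flip A [set u; v] u; rewrite -/B => ->.
by rewrite in_set2 eqxx addbT; case: (u \in oddv A) => /=; rewrite minC.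
Qed.

(** A flip lowers [lam] by at most a factor [w], and each inverse degree is at least the inverse of
    [maxdeg]. When two inverse degrees are added, one of them is dropped. *)
Lemma rho_rate_ge A u v : adj u v ->
  w / (2 * (maxdeg adj)%:R) * lam A <= rho A * rate A u v.
Proof.
move=> a; set B := A :+: [set [set u; v]].
have hu := deg_gt0 a; have hv := deg_gt0r a; have hl := lam_gt0 A.
have mu := deg_le_max u; have mv := deg_le_max v.
set m : R := (maxdeg adj)%:R in mu mv *.
have hm : 0 < m := lt_le_trans hu mu.
have ge_inv (d : R) : 0 < d -> d <= m -> m^-1 <= d^-1.
  by move=> d0 dm; rewrite lef_pV2.
have E : w / (2 * m) * lam A = 2^-1 * (w * lam A * m^-1).
  by field; rewrite gt_eqF.
have wl : 0 <= w * lam A by rewrite mulr_ge0 // ltW.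
rewrite E; have [h|] := boolP ((#|oddv A| == 0%N) || (#|oddv B| == 0%N)).
  rewrite (rho_rate_end a) // -[leRHS]mulrA ler_pM2l ?invr_gt0 //.
  apply: ler_pM; rewrite ?invr_ge0 ?(ltW hm) //.
    rewrite mulrC ler_pM2l //; case: ifP => // _; exact: ltW.
  by rewrite ler_wpDr ?ge_inv // invr_ge0 ltW.
rewrite negb_or => /andP[A0 B0]; rewrite (rho_rate_mid a) // ler_pM2l ?invr_gt0 // -/B.
have lB : w * lam A <= lam B.
  rewrite lam_flip mulrC ler_pM2l //; case: ifP => // _.
  by apply: (@le_trans _ _ 1); rewrite ?invf_ge1 // ltW.
have lA : w * lam A <= lam A by rewrite ger_pMl // ltW.
by case: ifP => _; rewrite le_min !ler_pM ?ge_inv ?invr_ge0 // ltW.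
Qed.

(** * Nonnegativity, reversibility and laziness of the off-diagonal part *)

Lemma rate_ge0 A u v : 0 <= rate A u v.
Proof.
rewrite /Defs.rate; have w0 := ltW w_gt0.
have m0 (x y t : R) : 0 <= x -> 0 <= y -> 0 <= t -> 0 <= Num.min (x / y * t) 1 * (4 * x)^-1.
  move=> x0 y0 t0; rewrite mulr_ge0 ?invr_ge0 ?mulr_ge0 // le_min ler01 andbT.
  by rewrite !mulr_ge0 ?invr_ge0.
case: ifP => _; first by rewrite !mulr_ge0 ?invr_ge0 ?mulr_ge0 ?addr_ge0 ?invr_ge0 //; case: ifP.
case: ifP => _; first by rewrite !mulr_ge0 ?invr_ge0 ?addr_ge0 ?invr_ge0 //; case: ifP.
by case: ifP => _; rewrite m0 //; case: ifP; rewrite ?invr_ge0.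
Qed.

Lemma Poff_ge0 A B : 0 <= Poff A B.
Proof.
rewrite mulr_ge0 ?invr_ge0 //; apply: sumr_ge0 => u _; apply: sumr_ge0 => v _.
exact: rate_ge0.
Qed.

Lemma sum_Poff A (F : ES -> R) :
  \sum_(B in W) Poff A B * F B =
  2^-1 * \sum_u \sum_(v | adj u v && (A :+: [set [set u; v]] \in W))
     rate A u v * F (A :+: [set [set u; v]]).
Proof.
rewrite mulr_sumr; under eq_bigr => B _.
  rewrite /Defs.Poff -mulrA mulr_suml mulr_sumr; over.
rewrite exchange_big /=; apply: eq_bigr => u _.
under eq_bigr => B _.
  rewrite mulr_suml mulr_sumr big_mkcondr /=; over.
rewrite exchange_big /= mulr_sumr [in RHS]big_mkcondr /=; apply: eq_bigr => v _.
by rewrite -big_mkcondr /= big_mkcond /= -big_mkcond big_andbC big_mkcondr /= big_pred1_eq.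
Qed.

Lemma rho_Poff_sym A B : A \in W -> B \in W -> rho A * Poff A B = rho B * Poff B A.
Proof.
move=> AW BW; rewrite /Defs.Poff mulrCA [RHS]mulrCA; congr (_ * _).
rewrite !mulr_sumr; apply: eq_bigr => u _; rewrite !mulr_sumr.
apply: eq_big => [v|v /andP[a /eqP E]].
  by congr (_ && _); apply/eqP/eqP => ->; rewrite symdiffK.
by rewrite E (rho_rate_sym a) // -E.
Qed.

(** Each vertex of [S] contributes 1, or 0 if it is isolated; hence an inequality. *)
Lemma sum_adj_deg (S : {set T}) :
  \sum_u \sum_(v | adj u v) (u \in S)%:R / dg u <= #|S|%:R.
Proof.
rewrite -sum1_card natr_sum big_mkcond /= [X in _ <= X]big_mkcond; apply: ler_sum => u _.
rewrite sumr_const; case: (u \in S); last by rewrite mul0r mul0rn.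
rewrite -[leLHS]mulr_natr /= mul1r.
have -> : #|[pred v | adj u v]| = deg adj u by apply: eq_card => v; rewrite !inE.
have [->|n0] := eqVneq (dg u) 0; first by rewrite mulr0 ler01.
by rewrite mulVf.
Qed.

Lemma sum_adj_degr (S : {set T}) :
  \sum_u \sum_(v | adj u v) (v \in S)%:R / dg v <= #|S|%:R.
Proof.
rewrite (exchange_big_dep xpredT) //=; apply: le_trans (sum_adj_deg S).
by apply: ler_sum => u _; under eq_bigl do rewrite adj_sym.
Qed.

(** The bound is the proposal probability: with probability 1/2, a uniform vertex of [S] (of size
    [psi A]) and then a uniform neighbour. The acceptance factors are at most 1. *)
Lemma rate_le A u v : A \in W -> adj u v -> A :+: [set [set u; v]] \in W ->
  let S := if #|oddv A| == 0%N then setT else oddv A in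
  rate A u v <= (2 * psi A)^-1 * ((u \in S)%:R / dg u + (v \in S)%:R / dg v).
Proof.
move=> AW a BW; rewrite /psi /Defs.rate.
have hu := deg_gt0 a; have hv := deg_gt0r a.
have s1 : (if [set u; v] \in A :+: M then 1 else w) <= 1 by case: ifP => // _; exact: ltW.
have e4 : (4^-1 : R) = (2 * 2)^-1 by rewrite -natrM.
case: (boolP (#|oddv A| == 0%N)) => A0.
  rewrite !in_setT !mul1r; apply: ler_piMl => //.
  by rewrite mulr_ge0 ?invr_ge0 ?mulr_ge0 // addr_ge0 ?invr_ge0.
case: (boolP (#|oddv (A :+: _)| == 0%N)) => B0.
  have /andP[-> ->] := oddv_flip_both (eqP B0).
  rewrite !mul1r -e4; apply: ler_piMl => //.
  by rewrite mulr_ge0 ?invr_ge0 // addr_ge0 ?invr_ge0.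
rewrite (oddv_flip_one a AW BW A0 B0).
have key (x t : R) : Num.min t 1 * (4 * x)^-1 = (2 * 2)^-1 * (Num.min t 1 * x^-1).
  by rewrite invfM -e4 mulrCA.
by case: (u \in oddv A) => /=; rewrite ?mul0r ?mul1r ?addr0 ?add0r key ler_pM2l
  ?invr_gt0 ?mulr_gt0 //; apply: ler_piMl; rewrite ?invr_ge0 ?ge_min ?lexx ?orbT.
Qed.

Lemma sum_Poff_le_half A : A \in W -> \sum_(B in W) Poff A B <= 2^-1.
Proof.
move=> AW.
have -> : \sum_(B in W) Poff A B = \sum_(B in W) Poff A B * 1.
  by apply: eq_bigr => B _; rewrite mulr1.
rewrite (sum_Poff A (fun=> 1)) -[leRHS]mulr1 ler_pM2l ?invr_gt0 //.
set S := if #|oddv A| == 0%N then setT else oddv A.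
have psi_ge0 : 0 <= psi A by rewrite /psi; case: ifP.
have step : \sum_u \sum_(v | adj u v && (A :+: [set [set u; v]] \in W)) rate A u v * 1 <=
    (2 * psi A)^-1 * (\sum_u \sum_(v | adj u v) (u \in S)%:R / dg u +
                      \sum_u \sum_(v | adj u v) (v \in S)%:R / dg v).
  rewrite -big_split mulr_sumr; apply: ler_sum => u _ /=.
  rewrite -big_split mulr_sumr big_mkcondr /=; apply: ler_sum => v a.
  case: ifP => BW; first by rewrite mulr1; exact: rate_le.
  by rewrite mulr_ge0 ?invr_ge0 ?addr_ge0 ?mulr_ge0 ?invr_ge0.
apply: le_trans step _.
have Spsi : #|S|%:R = psi A.
  rewrite /S /psi; case: (boolP (_ == _)) => A0; first by rewrite cardsT.
  by rewrite (card_oddv_W AW A0).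
have h : \sum_u \sum_(v | adj u v) (u \in S)%:R / dg u +
    \sum_u \sum_(v | adj u v) (v \in S)%:R / dg v <= 2 * psi A.
  by rewrite mulr2n mulrDl mul1r -Spsi lerD ?sum_adj_deg ?sum_adj_degr.
(* [psi A] is 0 only for an empty vertex type; its inverse is then 0 by convention. *)
have [z|nz] := eqVneq (psi A) 0; first by rewrite z mulr0 invr0 mul0r.
apply: le_trans (ler_wpM2l _ h) _; first by rewrite invr_ge0 mulr_ge0.
by rewrite mulVf // mulf_neq0 // pnatr_eq0.
Qed.

(** * Sums over edges and over states *)

Lemma sqr_sum_le (I : finType) (D : {set I}) (a : I -> R) :
  (\sum_(i in D) a i) ^+ 2 <= #|D|%:R * \sum_(i in D) a i ^+ 2.
Proof.
set S := \sum_(i in D) a i ^+ 2.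
have E : #|D|%:R * S = \sum_(i in D) \sum_(j in D) (2^-1 * a i ^+ 2 + 2^-1 * a j ^+ 2).
  have inner i : \sum_(j in D) (2^-1 * a i ^+ 2 + 2^-1 * a j ^+ 2) =
      #|D|%:R * 2^-1 * a i ^+ 2 + 2^-1 * S.
    by rewrite big_split sumr_const /= -mulr_sumr -[X in X + _]mulr_natl mulrA.
  rewrite (eq_bigr _ (fun i _ => inner i)) big_split sumr_const -mulr_sumr /=.
  by rewrite -/S -[X in _ = _ + X]mulr_natl; field.
rewrite E expr2 mulr_suml; apply: ler_sum => i _; rewrite mulr_sumr.
by apply: ler_sum => j _; have := sqr_ge0 (a i - a j); lra.
Qed.

Lemma reindex_symdiff (X : ES) (P : pred ES) (F : ES -> R) :
  \sum_(A | P A) F A = \sum_(A | P (A :+: X)) F (A :+: X).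
Proof.
apply: (reindex (fun A => A :+: X)); apply: onW_bij.
by exists (fun A => A :+: X) => A; rewrite symdiffK.
Qed.

Lemma sum_edges_le (P : pred {set T}) (h : {set T} -> R) :
  (forall e, 0 <= h e) ->
  \sum_(e in edges adj | P e) h e <= \sum_u \sum_(v | adj u v && P [set u; v]) h [set u; v].
Proof.
move=> h0; rewrite pair_big_dep /=.
rewrite (partition_big (fun uv : T * T => [set uv.1; uv.2])
          (fun e => (e \in edges adj) && P e)) /=; last first.
  by move=> [u v] /= /andP[a ->]; rewrite mem_edges.
apply: ler_sum => e /andP[/edgesP[u [v [a ->]]] Pe].
rewrite (bigD1 (u, v)) /=; last by rewrite a Pe eqxx.
by rewrite ler_wpDr // sumr_ge0.
Qed.

Local Notation l k := (lamS w M (Ck adj k)).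

Lemma lamS_C0_gt0 : 0 < l 0.
Proof.
rewrite /lamS (bigD1 set0) /=; last by rewrite CkE sub0set oddv0 cards0.
by rewrite ltr_wpDr ?lam_gt0 // sumr_ge0 // => A _; rewrite ltW // lam_gt0.
Qed.

Lemma sum_lam_W : \sum_(A in W) lam A = l 0 + l 2.
Proof.
rewrite /Wset /lamS; rewrite -bigU //=; first by apply: eq_bigl => A; rewrite inE.
by apply/pred0P => A /=; rewrite !CkE; case: #|oddv A| => [|n]; rewrite ?andbF.
Qed.

Lemma sum_lam_W4 : \sum_(A in W :|: Ck adj 4) lam A = l 0 + l 2 + l 4.
Proof.
rewrite -sum_lam_W /lamS -bigU //=; first by apply: eq_bigl => A; rewrite inE.
apply/pred0P => A /=; rewrite WsetE CkE.
by case: (#|oddv A| =P 4%N) => [->|]; rewrite ?andbF.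
Qed.

(** * Paths, congestion and the Poincare inequality *)

Section Poincare.
Variable pre : ES -> {set T} -> ES.
Hypothesis preP : forall D : ES, D \subset edges adj -> (#|oddv D| <= 2)%N ->
  unwinds R D (pre D).

(* The path from [A] to the even subgraph [A :+: D] passes through [X], where it
   flips [e], exactly when [A = X :+: pre D e]. *)
Definition routed (X D : ES) (e : {set T}) :=
  [&& e \in D, X :+: pre D e \in W & X :+: pre D e :+: D \in Ck adj 0].

Lemma target_good A D : A \in W -> A :+: D \in Ck adj 0 ->
  [/\ D \subset edges adj, (#|oddv D| <= 2)%N & oddv D = oddv A].
Proof.
rewrite WsetE CkE => /andP[AE A2] /andP[BE /eqP B0].
have E : oddv D = oddv A.
  by rewrite -(oddv_symdiff_even A B0) symdiffC symdiffKl.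
split=> //; last by rewrite E.
by rewrite -(symdiffKl A D) symdiff_sub.
Qed.

Lemma routedP X D e : routed X D e ->
  [/\ X \in W, e \in edges adj, X :+: [set e] \in W, pre D e \subset D &
      X :+: D \in (if #|oddv (X :+: pre D e)| == 0%N then W else W :|: Ck adj 4)].
Proof.
case/and3P => eD AW BC; have [DE D2 DA] := target_good AW BC.
have [/(_ e eD)[pD p2 p2e] _] := preP DE D2.
have eE := subsetP DE e eD.
have XE : X \subset edges adj.
  rewrite -(symdiffK (pre D e) X) symdiff_sub //; first by move: AW; rewrite WsetE => /andP[].
  exact: subset_trans pD DE.
move: (BC); rewrite CkE => /andP[_ /eqP B0].
(* Seen from the even target, [X] differs only by the part of [D] still to be flipped, so it has the
   odd vertices of [D :+: pre D e]. *)
have X2 : (#|oddv X| <= 2)%N.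
  have -> : X = (X :+: pre D e :+: D) :+: (D :+: pre D e).
    apply/setP => x; rewrite !in_symdiff.
    by case: (x \in X); case: (x \in D); case: (x \in pre D e).
  by rewrite oddv_symdiff_even.
have Xe2 : (#|oddv (X :+: [set e])| <= 2)%N.
  have -> : X :+: [set e] = (X :+: pre D e :+: D) :+: (D :+: pre D e :+: [set e]).
    apply/setP => x; rewrite !in_symdiff.
    by case: (x \in X); case: (x \in D); case: (x \in pre D e);
      case: (x \in [set e]).
  by rewrite oddv_symdiff_even.
have XDE : X :+: D \subset edges adj by rewrite symdiff_sub.
split=> //; rewrite ?WsetE ?XE ?X2 ?Xe2 ?symdiff_sub ?sub1set //.
(* From an even start, [D] is even too, so [X :+: D] has the odd vertices of [X]. Otherwise [X] and
   [D] have at most two each, and parity leaves 0, 2 or 4. *)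
case: eqP => A0.
  by rewrite WsetE XDE symdiffC oddv_symdiff_even // DA.
rewrite in_setU WsetE CkE XDE /=.
have := card_oddv_symdiff X D; have := even_oddv XDE.
by move: #|oddv (X :+: D)| => k; lia.
Qed.

(** The first term accounts for paths from even starts, where [psi] is [#|T|] and [eta] lies in [W];
    the second for starts with two odd vertices, where [psi] is 2 and [eta] may have four. *)
Definition load := #|T|%:R * (l 0 + l 2) + 2 * (l 0 + l 2 + l 4).

Lemma congestion X e :
  \sum_(D | routed X D e) psi (X :+: pre D e) * lam (X :+: D) <= load.
Proof.
rewrite (reindex_symdiff X) /=.
rewrite /load -sum_lam_W4 -sum_lam_W !mulr_sumr.
rewrite big_mkcond [X in _ <= X + _]big_mkcond [X in _ <= _ + X]big_mkcond -big_split.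
apply: ler_sum => eta _ /=; set D := eta :+: X.
have lE : X :+: D = eta by rewrite symdiffC symdiffK.
have l0 := ltW (lam_gt0 eta).
case: ifP => [/routedP[_ _ _ _]|_]; last first.
  by rewrite addr_ge0 //; case: ifP => // _; rewrite mulr_ge0.
rewrite lE /psi; case: ifP => _ ->.
  by rewrite lerDl; case: ifP => // _; rewrite mulr_ge0.
by rewrite lerDr; case: ifP => // _; rewrite mulr_ge0.
Qed.

Variable g : ES -> R.
Local Notation G X e := ((g X - g (X :+: [set e])) ^+ 2).

(** Expanding the square, the cross term vanishes by the mean-zero hypothesis and the term in
    [g B ^+ 2] is nonnegative. *)
Lemma variance_le :
  \sum_(A in W) rho A * g A = 0 ->
  l 0 * \sum_(A in W) rho A * g A ^+ 2 <=
  \sum_(A in W) \sum_(B in Ck adj 0) rho A * lam B * (g A - g B) ^+ 2.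
Proof.
move=> mean0; rewrite exchange_big /= mulr_suml; apply: ler_sum => B _.
have -> : \sum_(A in W) rho A * lam B * (g A - g B) ^+ 2 =
    lam B * (\sum_(A in W) rho A * g A ^+ 2 - 2 * g B * (\sum_(A in W) rho A * g A)
             + g B ^+ 2 * \sum_(A in W) rho A).
  rewrite !mulr_sumr -sumrB -big_split mulr_sumr.
  by apply: eq_bigr => A _ /=; ring.
rewrite mean0 mulr0 subr0 ler_pM2l ?lam_gt0 // lerDl mulr_ge0 ?sqr_ge0 //.
apply: sumr_ge0 => A _; rewrite mulr_ge0 ?(ltW (lam_gt0 _)) //.
by rewrite /psi; case: ifP.
Qed.

(** Cauchy-Schwarz along the path, whose length [#|D|] is at most the number of edges. *)
Lemma paths_le A : A \in W ->
  \sum_(B in Ck adj 0) rho A * lam B * (g A - g B) ^+ 2 <=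
  #|edges adj|%:R * \sum_(D | A :+: D \in Ck adj 0) \sum_(e in D)
     psi A * (lam A * lam (A :+: D)) * G (A :+: pre D e) e.
Proof.
move=> AW; rewrite (reindex_symdiff A) mulr_sumr.
under eq_bigl do rewrite symdiffC.
apply: ler_sum => D DC; rewrite (symdiffC D A).
have [DE D2 _] := target_good AW DC.
have psi0 : 0 <= psi A by rewrite /psi; case: ifP.
rewrite -mulr_sumr [leRHS]mulrCA /rho -(mulrA (psi A)).
apply: ler_wpM2l; first by rewrite !mulr_ge0 // ltW // lam_gt0.
rewrite (preP DE D2).2; apply: le_trans (sqr_sum_le _ _) _.
apply: ler_wpM2r; first by apply: sumr_ge0 => e _; exact: sqr_ge0.
by rewrite ler_nat subset_leq_card.
Qed.

(** The sum over starts is regrouped by the transition used, through [A = X :+: pre D e];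
    [lam_exchange] then extracts [lam X] and leaves the sum bounded by [congestion]. *)
Lemma reroute :
  \sum_(A in W) \sum_(D | A :+: D \in Ck adj 0) \sum_(e in D)
     psi A * (lam A * lam (A :+: D)) * G (A :+: pre D e) e <=
  load * \sum_(X in W) \sum_(e in edges adj | X :+: [set e] \in W) lam X * G X e.
Proof.
have -> : \sum_(A in W) \sum_(D | A :+: D \in Ck adj 0) \sum_(e in D)
     psi A * (lam A * lam (A :+: D)) * G (A :+: pre D e) e =
   \sum_X \sum_e lam X * G X e *
     \sum_(D | routed X D e) psi (X :+: pre D e) * lam (X :+: D).
  transitivity (\sum_(D : ES) \sum_e \sum_(A | [&& e \in D, A \in W & A :+: D \in Ck adj 0])
     psi A * (lam A * lam (A :+: D)) * G (A :+: pre D e) e).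
    rewrite (exchange_big_dep xpredT) //=; apply: eq_bigr => D _.
    rewrite exchange_big big_mkcond; apply: eq_bigr => e _ /=.
    by case: (e \in D) => //; rewrite big_pred0.
  rewrite exchange_big [RHS]exchange_big /=; apply: eq_bigr => e _.
  under [RHS]eq_bigr do rewrite mulr_sumr.
  rewrite [RHS](exchange_big_dep xpredT) //=; apply: eq_bigr => D _.
  rewrite (reindex_symdiff (pre D e)); apply: eq_bigr => X rX.
  have [_ _ _ pD _] := routedP rX.
  by rewrite (lam_exchange _ pD) symdiffK; ring.
rewrite mulr_sumr [leRHS]big_mkcond; apply: ler_sum => X _.
have dead e : ~~ [&& X \in W, e \in edges adj & X :+: [set e] \in W] ->
    \sum_(D | routed X D e) psi (X :+: pre D e) * lam (X :+: D) = 0.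
  move=> h; apply: big_pred0 => D; apply: contraNF h.
  by case/routedP => -> -> ->.
case: ifP => XW; last by rewrite big1 // => e _; rewrite dead ?XW // mulr0.
rewrite mulr_sumr [leRHS]big_mkcond; apply: ler_sum => e _.
case: ifP => eW; last by rewrite dead ?XW ?eW // mulr0.
rewrite [leRHS]mulrC; apply: ler_wpM2l; last exact: congestion.
by rewrite mulr_ge0 ?sqr_ge0 // ltW // lam_gt0.
Qed.

(** [rho_rate_ge] gives [2 * maxdeg / w]; the remaining 2 offsets the [2^-1] in [Poff]. *)
Lemma edge_sum_le :
  \sum_(X in W) \sum_(e in edges adj | X :+: [set e] \in W) lam X * G X e <=
  4 * (maxdeg adj)%:R / w *
  \sum_(X in W) \sum_(Y in W) rho X * Poff X Y * (g X - g Y) ^+ 2.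
Proof.
rewrite mulr_sumr; apply: ler_sum => X XW.
apply: le_trans (sum_edges_le _ _) _.
  by move=> e; rewrite mulr_ge0 ?sqr_ge0 // ltW // lam_gt0.
have -> : \sum_(Y in W) rho X * Poff X Y * (g X - g Y) ^+ 2 =
    rho X * \sum_(Y in W) Poff X Y * (g X - g Y) ^+ 2.
  by rewrite mulr_sumr; apply: eq_bigr => Y _; rewrite mulrA.
rewrite (sum_Poff X (fun Y => (g X - g Y) ^+ 2)) !mulr_sumr; apply: ler_sum => u _.
rewrite !mulr_sumr; apply: ler_sum => v /andP[a _].
have m_gt0 : 0 < (maxdeg adj)%:R :> R := lt_le_trans (deg_gt0 a) (deg_le_max u).
have := rho_rate_ge X a; set m : R := (maxdeg adj)%:R in m_gt0 *.
set q := rate X u v; set G2 := _ ^+ 2 => H.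
have -> : 4 * m / w * (rho X * (2^-1 * (q * G2))) = 2 * m / w * (rho X * q) * G2.
  by field; rewrite gt_eqF.
apply: ler_wpM2r; first exact: sqr_ge0.
have -> : lam X = 2 * m / w * (w / (2 * m) * lam X).
  by field; rewrite !gt_eqF.
by apply: ler_wpM2l => //; rewrite !mulr_ge0 ?invr_ge0 // ltW.
Qed.

Lemma poincare_pre :
  \sum_(A in W) rho A * g A = 0 ->
  l 0 * \sum_(A in W) rho A * g A ^+ 2 <=
  #|edges adj|%:R * (load * (4 * (maxdeg adj)%:R / w *
   \sum_(X in W) \sum_(Y in W) rho X * Poff X Y * (g X - g Y) ^+ 2)).
Proof.
move=> /variance_le /le_trans; apply.
apply: (le_trans (ler_sum _ paths_le)); rewrite -mulr_sumr; apply: ler_wpM2l => //.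
apply: le_trans reroute _; apply: ler_wpM2l; last exact: edge_sum_le.
have l0 k : 0 <= l k by apply: sumr_ge0 => A _; exact: ltW (lam_gt0 A).
by rewrite addr_ge0 // mulr_ge0 // !addr_ge0.
Qed.
End Poincare.

Lemma poincare (chi2 chi4 : R) (g : ES -> R) :
  l 2 / l 0 <= chi2 -> l 4 / l 0 <= chi4 -> \sum_(A in W) rho A * g A = 0 ->
  \sum_(A in W) rho A * g A ^+ 2 <=
  8 * (maxdeg adj)%:R * w^-1 * #|edges adj|%:R *
    ((1 + chi2) * (2 + #|T|%:R) + 2 * chi4) *
  (2^-1 * \sum_(X in W) \sum_(Y in W) rho X * Poff X Y * (g X - g Y) ^+ 2).
Proof.
move=> h2 h4 mean0.
have [pre preP] := exists_unwindings R.
have H := poincare_pre preP mean0.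
have l0 := lamS_C0_gt0.
set E := \sum_(X in W) _ in H *.
have E0 : 0 <= E.
  apply: sumr_ge0 => X _; apply: sumr_ge0 => Y _; rewrite mulr_ge0 ?sqr_ge0 //.
  rewrite mulr_ge0 ?Poff_ge0 // mulr_ge0 ?(ltW (lam_gt0 _)) //.
  by rewrite /psi; case: ifP.
rewrite -(ler_pM2l l0); apply: le_trans H _.
rewrite ler_pdivrMr // in h2; rewrite ler_pdivrMr // in h4.
(* [load] regroups as [(2 + #|T|) * (l 0 + l 2) + 2 * l 4]. *)
have K_le : load <= l 0 * ((1 + chi2) * (2 + #|T|%:R) + 2 * chi4).
  have T0 : 0 <= #|T|%:R :> R by [].
  rewrite /load; move: (#|T|%:R : R) (l 0) (l 2) (l 4) T0 h2 h4 => t a b c t0 h2 h4.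
  by nra.
set K := (1 + chi2) * _ + _ in K_le *.
have -> : l 0 * (8 * (maxdeg adj)%:R * w^-1 * #|edges adj|%:R * K * (2^-1 * E)) =
    #|edges adj|%:R * (l 0 * K * (4 * (maxdeg adj)%:R / w * E)).
  by field; rewrite gt_eqF.
apply: ler_wpM2l => //; apply: ler_wpM2r => //.
by rewrite !mulr_ge0 ?invr_ge0 // ltW.
Qed.
End EdgeSets.

(** * The transition matrix on the state type *)

Section WormChain.
Set Implicit Arguments.
Unset Strict Implicit.
Variables (T : finType) (adj : rel T) (R : realType) (w : R) (M : {set {set T}}).
Hypotheses (adj_sym : symmetric adj) (adj_irr : irreflexive adj).
Hypotheses (w_gt0 : 0 < w) (w_lt1 : w < 1).

Local Notation P := (@Pw T adj R w M).
Local Notation St := (Wty adj).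

Lemma sum_Wty (F : {set {set T}} -> R) :
  \sum_(x : St) F (val x) = \sum_(A in Wset adj) F A.
Proof.
rewrite [RHS](reindex_omap (val : St -> _) insub) => [|A AW].
  by apply: eq_bigl => x; rewrite valK eqxx andbT (valP x).
by rewrite insubT.
Qed.

Lemma Pw_off (x y : St) : x != y -> P x y = Poff adj w M (val x) (val y).
Proof. by rewrite /Pw => /negbTE ->. Qed.

Lemma sum_Pw (x : St) : \sum_y P x y = 1.
Proof.
rewrite (bigD1 x) //= {1}/Pw eqxx.
rewrite [X in _ + X](eq_bigr (fun y => Poff adj w M (val x) (val y))) ?subrK // => y yx.
by rewrite Pw_off // eq_sym.
Qed.

Lemma Pw_lazy (x : St) : 2^-1 <= P x x.
Proof.
rewrite /Pw eqxx.
have : \sum_(C : St | C != x) Poff adj w M (val x) (val C) <= 2^-1.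
  apply: le_trans (sum_Poff_le_half adj_sym adj_irr M w_lt1 (valP x)).
  rewrite -sum_Wty [leRHS](bigD1 x) //= lerDr; exact: Poff_ge0.
by move: (\sum_(_ | _) _) => S; lra.
Qed.

Lemma Pw_ge0 (x y : St) : 0 <= P x y.
Proof.
have [->|xy] := eqVneq x y; last by rewrite Pw_off // Poff_ge0.
by apply: le_trans (Pw_lazy y); rewrite invr_ge0.
Qed.

Lemma Pw_rev (x y : St) : rho w M (val x) * P x y = rho w M (val y) * P y x.
Proof.
have [-> //|xy] := eqVneq x y.
by rewrite !Pw_off // 1?eq_sym //; apply: rho_Poff_sym; rewrite ?(valP x) ?(valP y).
Qed.

(** [P] and [Poff] may differ on the diagonal, where the squared difference is 0. *)
Lemma dirichlet_Pw (g : {set {set T}} -> R) :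
  dirichlet P (fun x : St => rho w M (val x)) (fun x => g (val x)) =
  2^-1 * \sum_(X in Wset adj) \sum_(Y in Wset adj)
     rho w M X * Poff adj w M X Y * (g X - g Y) ^+ 2.
Proof.
rewrite /dirichlet -sum_Wty; congr (_ * _); apply: eq_bigr => x _.
rewrite -sum_Wty; apply: eq_bigr => y _.
have [->|xy] := eqVneq x y; last by rewrite Pw_off.
by rewrite subrr expr0n /= !mulr0.
Qed.
End WormChain.

Theorem theorem1 (T : finType) (adj : rel T)
  (adj_sym : symmetric adj) (adj_irr : irreflexive adj)
  (R : realType) (w : R) (M : {set {set T}}) (chi2 chi4 : R) :
  0 < w -> w < 1 -> M \subset edges adj ->
  lamS w M (Ck adj 2) / lamS w M (Ck adj 0) <= chi2 ->
  lamS w M (Ck adj 4) / lamS w M (Ck adj 0) <= chi4 ->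
  trel_le adj w M
    (8 * (maxdeg adj)%:R * w^-1 * (#|edges adj|)%:R *
     ((1 + chi2) * (2 + (#|T|)%:R) + 2 * chi4)).
Proof.
move=> w_gt0 w_lt1 _ h2 h4; rewrite /trel_le /Pmx.
have P_ge0 := Pw_ge0 M adj_sym adj_irr w_gt0 w_lt1.
have P_lazy := Pw_lazy M adj_sym adj_irr w_gt0 w_lt1.
have [T0|T_gt0] := posnP #|T|.
  (* Here [rho] vanishes, but there is a single state. *)
  have single (x y : Wty adj) : x = y.
    apply: val_inj; have sub0 (z : Wty adj) : val z = set0.
      apply/eqP; rewrite -subset0; apply/subsetP => e.
      have := valP z; rewrite (WsetE adj_irr) => /andP[/subsetP zE _] /zE /edgesP[u _].
      by have := fintype0 u T0.
    by rewrite !sub0.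
  apply: (rev_eigenvalue_gap (r := fun=> 1)) => //.
  - by move=> x y; rewrite (single x y).
  - exact: sum_Pw.
  move=> g; under eq_bigr do rewrite mul1r; move=> g0.
  have {}g0 x : g x = 0.
    by rewrite -g0 (bigD1 x) //= big_pred0 ?addr0 // => y; rewrite (single y x) eqxx.
  rewrite big1 => [|x _]; last by rewrite g0 expr0n mulr0.
  by rewrite /dirichlet big1 ?mulr0 // => x _;
    rewrite big1 // => y _; rewrite !g0 subrr expr0n mulr0.
apply: (rev_eigenvalue_gap (r := fun x => rho w M (val x))) => //.
- move=> x; rewrite mulr_gt0 ?lam_gt0 // /psi.
  by case: ifP; rewrite ltr0n.
- exact: Pw_rev.
- exact: sum_Pw.
move=> g0 mean0.
(* [poincare] takes functions of all edge sets, so [g0] is extended by 0 outside the state space. *)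
pose g A := if insub A is Some x then g0 x else 0 : R.
have gE (x : Wty adj) : g0 x = g (val x) by rewrite /g valK.
have g0E : g0 = fun x => g (val x) by apply: funext.
move: mean0; rewrite g0E dirichlet_Pw.
rewrite (sum_Wty adj (fun A => rho w M A * g A)) (sum_Wty adj (fun A => rho w M A * g A ^+ 2)).
exact: poincare.
Qed.
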